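(* Let $\sigma:[0,\infty)\to[0,\infty)$ be nondecreasing with $\lim_{t\to\infty}\sigma(t)=\infty$ and let $\beta\ge0$. Take $a\ge0$ such that $\sigma(x)>0$ for all $x\ge a$ and $\sigma(x)=0$ for every $x\le\lceil a\rceil-1$. Then the following are equivalent: (i) there exists $C>0$ such that $\int_1^{y}\frac{\sigma(t)}{t^{\beta+1}}\,dt\le C\frac{\sigma(y)}{y^{\beta}}$ for all $y\ge1$; (ii) $\lim_{k\to\infty}\liminf_{t\to\infty}\frac{\sigma(kt)}{k^{\beta}\sigma(t)}=\infty$; (iii) there exists $K>1$ such that $\liminf_{t\to\infty}\frac{\sigma(Kt)}{\sigma(t)}>K^{\beta}$; (iv) $\beta(\sigma)>\beta$; (v) there exists $\gamma>\beta$ such that $t\mapsto\sigma(t)/t^{\gamma}$ is almost increasing in $[a,\infty)$ if $a>0$, and in $[\varepsilon,\infty)$ for all $\varepsilon>0$ if $a=0$; (vi) there exists $C>0$ such that $\frac{1}{y^{\beta}}\int_y^{\infty}\frac{t^{\beta-1}}{\sigma(t)}\,dt\le\frac{C}{\sigma(y)}$ for all $y\ge a$ if $a>0$, and for all $y\ge\varepsilon$ if $a=0$, where $\varepsilon>0$ is arbitrary but fixed and $C$ depends on $\varepsilon$; (vii) there exists $C>0$ such that $\sum_{k=p}^{\infty}\frac{k^{\beta-1}}{\sigma(k)}\le C\frac{p^{\beta}}{\sigma(p)}$ for every $p\in\mathbb{N}$ with $p\ge a$; (viii) for every $\theta\in(0,1)$ there exists $k\in\mathbb{N}$, $k\ge2$,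 such that $\sigma(p)\le\theta k^{-\beta}\sigma(kp)$ for every $p\in\mathbb{N}$; (ix) there exists $k\in\mathbb{N}$, $k\ge2$, such that $\liminf_{p\in\mathbb{N},\,p\to\infty}\frac{\sigma(kp)}{\sigma(p)}>k^{\beta}$; (x) there exists $C>0$ such that $\sum_{k=1}^{p}\frac{\sigma(k)}{k^{1+\beta}}\le C\frac{\sigma(p)}{p^{\beta}}$ for every $p\in\mathbb{N}$.
   Context: $\mathbb{N}=\{1,2,\dots\}$, $\lceil x\rceil=\min\{k\in\mathbb{Z}:x\le k\}$. A function $h$ on $[a,\infty)$ is almost increasing if there is $M>0$ with $h(x)\le M h(y)$ for all $a\le x\le y$. For a measurable positive function $f$ on some $[A,\infty)$, its lower Matuszewska index is $\beta(f):=\sup\{\beta\in\mathbb{R}:\exists D_\beta>0\ \forall\Lambda>1,\ \liminf_{x\to\infty}\inf_{\lambda\in[1,\Lambda]}\frac{f(\lambda x)}{\lambda^{\beta}f(x)}\ge D_\beta\}$ (with $\sup\emptyset=-\infty$); for $\sigma$ as in the claim, $\beta(\sigma)$ means the index of the restriction of $\sigma$ to any $[A,\infty)$ with $A>0$ on which $\sigma>0$ (independent of $A$). *)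

(* Defs.v *)
From HB Require Import structures.
From mathcomp Require Import all_boot all_order all_algebra.
From mathcomp Require Import all_classical all_reals all_analysis.
Set Implicit Arguments. Unset Strict Implicit. Unset Printing Implicit Defensive.
Import Order.TTheory GRing.Theory Num.Theory.
Import numFieldNormedType.Exports.
Local Open Scope classical_set_scope.
Local Open Scope ring_scope.

Definition liminf_pinfty {R : realType} (f : R -> \bar R) : \bar R :=
  limf_einf f (pinfty_nbhs R).

Definition almost_increasing {R : realType} (h : R -> R) (a : R) : Prop :=
  exists M : R, 0 < M /\ forall x y, a <= x -> x <= y -> h x <= M * h y.

Definition matuszewska_lower {R : realType} (f : R -> R) : \bar R :=
  ereal_sup [set (b%:E)%E | b in
    [set b : R | exists D : R, 0 < D /\ forall L : R, 1 < L ->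
       (D%:E <= liminf_pinfty (fun x : R =>
          ereal_inf [set ((f (lam * x) / (lam `^ b * f x))%:E)%E
                    | lam in `[1%R, L]%classic]))%E]].

(* Main.v *)
(** Write H(x) = sigma(x) / x^beta.  Every condition is compared with one core
  property ([grows_above]): sigma(x) / x^g is eventually almost increasing for
  some g > beta.  This property makes H(x) <= theta H(y) as soon as y >= k x, for
  k depending on theta, so that the integrals and sums, cut at the points x, kx,
  k^2 x, ..., are dominated by geometric series.  Conversely, if F is the integral
  (or sum) of sigma(t) / t^(beta + 1) up to y, then F(2y) - F(y) >= c H(y) >=
  (c / C) F(y), so F, and hence H, grows geometrically along y, 2y, 4y, ...; the
  tails of t^(beta - 1) / sigma(t) decay geometrically for the same reason.
  Geometric growth of H along powers of K > 1 at a rate q > 1 gives the core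
  property with K^(g - beta) = q. *)

Require Import Defs.
From HB Require Import structures.
From mathcomp Require Import all_boot all_order all_algebra.
From mathcomp Require Import all_classical all_reals all_analysis.
From mathcomp Require Import measurable_realfun ring lra.
Import Order.TTheory GRing.Theory Num.Theory.
Import numFieldNormedType.Exports.
Local Open Scope classical_set_scope.
Local Open Scope ring_scope.
Set Implicit Arguments.
Unset Strict Implicit.
Unset Printing Implicit Defensive.

(** * Growth above a power *)

Section Growth.
Variable R : realType.
Implicit Types (s : R -> R) (b g x y : R).

(** * Lower limits and real powers *)

Lemma limf_einf_ge (X : choiceType) (Y : filteredType X) (f : Y -> \bar R)
    (F : set_system Y) (c : \bar R) :
  F [set x | (c <= f x)%E] -> (c <= @limf_einf X Y R f F)%E.
Proof.
move=> Fc; rewrite limf_einfE; apply: le_ereal_sup_tmp.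
exists (ereal_inf (f @` [set x | (c <= f x)%E])).
  by exists [set x | (c <= f x)%E].
by apply/ereal_infP => _ [x cx <-].
Qed.

(** The lower limit is a supremum of infima, so one set of the filter already has infimum above [m].
    The gap is kept as a real [c], which later supplies a growth rate above 1. *)
Lemma limf_einf_gt (X : choiceType) (Y : filteredType X) (f : Y -> \bar R)
    (F : set_system Y) (m : R) : Filter F -> (m%:E < @limf_einf X Y R f F)%E ->
  exists c, m < c /\ \forall x \near F, (c%:E <= f x)%E.
Proof.
move=> FF; rewrite limf_einfE => /ereal_sup_gt[_ [A FA <-] mA].
have [c mc cA] : exists2 c, m < c & (c%:E <= ereal_inf (f @` A))%E.
  case: (ereal_inf _) mA => [r|_|//]; first by rewrite lte_fin; exists r.
  by exists (m + 1); rewrite ?ltrDl ?leey.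
exists c; split=> //; apply: (filterS _ FA) => x Ax; apply: (le_trans cA).
by apply: ereal_inf_lbound; exists x.
Qed.

Lemma powR_nat_ge (d r : R) : 0 < d ->
  exists k : nat, (2 <= k)%N /\ forall y, k%:R <= y -> r <= y `^ d.
Proof.
move=> d0; pose u := Num.max r 0.
(* One unit of [.+2] rounds the root up, the other secures [2 <= k]. *)
exists (Num.truncn (u `^ d^-1)).+2; split=> // y ky.
apply: (@le_trans _ _ u); first by rewrite le_max lexx.
have -> : u = (u `^ d^-1) `^ d.
  by rewrite -powRrM mulVf ?gt_eqF// powRr1// le_max lexx orbT.
have uy : u `^ d^-1 <= y.
  by rewrite ltW// (lt_le_trans (truncnS_gt _))// (le_trans _ ky)// ler_nat.
by rewrite ge0_ler_powR ?nnegrE ?powR_ge0 ?(ltW d0)// (le_trans _ uy)// powR_ge0.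
Qed.

Lemma near_pinfty_ex (P : R -> Prop) (r : R) :
  (\forall x \near +oo, P x) -> exists A, r < A /\ forall x, A <= x -> P x.
Proof.
move=> [A [_ PA]]; exists (Num.max A r + 1); split.
  by rewrite (@le_lt_trans _ _ (Num.max A r)) ?ltrDl// le_max lexx orbT.
move=> x Ax; apply: PA; apply: lt_le_trans Ax.
by rewrite (@le_lt_trans _ _ (Num.max A r)) ?ltrDl// le_max lexx.
Qed.

Lemma ltr_expn_ex (K x : R) : 1 < K -> exists n, x < K ^+ n.
Proof.
move=> K1; have bernoulli n : 1 + n%:R * (K - 1) <= K ^+ n.
  elim: n => [|n IH]; first by rewrite mul0r addr0 expr0.
  have n0 : 0 <= n%:R :> R by [].
  rewrite exprS -natr1; apply: (@le_trans _ _ (K * (1 + n%:R * (K - 1)))).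
    by have := mulr_ge0 n0 (sqr_ge0 (K - 1)); lra.
  by rewrite ler_pM2l//; lra.
exists (Num.truncn (x / (K - 1))).+1; apply: lt_le_trans (bernoulli _).
have := truncnS_gt (x / (K - 1)); rewrite ltr_pdivrMr ?subr_gt0//; lra.
Qed.

Lemma powRD_gt0 (x b d : R) : 0 < x -> x `^ (b + d) = x `^ b * x `^ d.
Proof. by move=> x0; rewrite powRD// (gt_eqF x0) implybT. Qed.

Lemma powR_exprAC (x d : R) n : 0 <= x -> (x `^ d) ^+ n = (x ^+ n) `^ d.
Proof.
move=> x0; elim: n => [|n IH]; first by rewrite !expr0 powR1.
by rewrite !exprS IH powRM// exprn_ge0.
Qed.

Definition scaled s b x := s x / x `^ b.

(** The threshold [A] is left free because the ten conditions start at different points; for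
    monotone [s], [almost_increasing_extend] moves it to any positive point. *)
Definition grows_above s b :=
  exists g, b < g /\ exists A, 0 < A /\ almost_increasing (scaled s g) A.

Lemma scaledD s b d x : 0 < x -> scaled s (b + d) x * x `^ d = scaled s b x.
Proof.
move=> x0; rewrite /scaled powRD_gt0// invfM mulrA mulfVK//.
by rewrite gt_eqF// powR_gt0.
Qed.

Lemma scaled_ge0 s b x :
  (forall x, 0 <= x -> 0 <= s x) -> 0 <= x -> 0 <= scaled s b x.
Proof. by move=> s0 x0; rewrite divr_ge0 ?powR_ge0 ?s0. Qed.

(** Monotonicity controls the numerators and [y <= K * x] the powers: between points of ratio at
    most [K] only the factor [K ^ g] is lost. *)
Lemma scaled_le s g K x y :
  (forall x y, 0 <= x -> x <= y -> s x <= s y) ->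
  (forall x, 0 <= x -> 0 <= s x) ->
  0 <= g -> 0 < x -> x <= y -> y <= K * x ->
  scaled s g x <= K `^ g * scaled s g y.
Proof.
move=> smono s0 g0 x0 xy yKx; have y0 : 0 < y by exact: lt_le_trans xy.
have K0 : 0 < K by rewrite -(pmulr_lgt0 _ x0) (lt_le_trans y0).
rewrite /scaled ler_pdivrMr ?powR_gt0//.
rewrite [leRHS](_ : _ = (K * x) `^ g / y `^ g * s y); last first.
  by rewrite powRM ?(ltW K0) ?(ltW x0)//; ring.
apply: (@le_trans _ _ (s y)); first exact/smono/xy/ltW.
rewrite ler_peMl ?s0 ?(ltW y0)//.
rewrite ler_pdivlMr ?powR_gt0// mul1r ge0_ler_powR ?nnegrE ?(ltW y0)//.
by rewrite mulr_ge0// ltW.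
Qed.

(** Points of [[e, A]] have ratio at most [A / e], so [scaled_le] handles them; a pair on both sides
    of [A] is compared through [A] itself. *)
Lemma almost_increasing_extend s g A e :
  (forall x y, 0 <= x -> x <= y -> s x <= s y) ->
  (forall x, 0 <= x -> 0 <= s x) ->
  0 <= g -> 0 < A -> 0 < e ->
  almost_increasing (scaled s g) A -> almost_increasing (scaled s g) e.
Proof.
move=> smono s0 g0 A0 e0 [M [M0 HM]].
have Ae0 : 0 < (A / e) `^ g by rewrite powR_gt0 ?divr_gt0.
have max1 : 1 <= Num.max 1 M by rewrite le_max lexx.
(* [M] serves [A <= x]; the second summand serves [x < A], its maximum covering both [y <= A] and
   [A < y]. *)
exists (M + (A / e) `^ g * Num.max 1 M); split.
  by rewrite addr_gt0// mulr_gt0// (lt_le_trans ltr01).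
move=> x y ex xy.
have x0 : 0 < x by exact: lt_le_trans ex.
have y0 : 0 < y by exact: lt_le_trans xy.
have sy := scaled_ge0 g s0 (ltW y0).
have [Ax|xA] := leP A x.
  apply: (le_trans (HM _ _ Ax xy)); rewrite ler_wpM2r// lerDl.
  by rewrite mulr_ge0 ?(ltW Ae0)// (le_trans ler01).
have xAe z : z <= A -> z <= A / e * x.
  move=> zA; apply: (le_trans zA); rewrite -mulrA ler_peMr ?(ltW A0)//.
  by rewrite mulrC ler_pdivlMr// mul1r.
apply: (@le_trans _ _ ((A / e) `^ g * (Num.max 1 M * scaled s g y))); last first.
  by rewrite mulrA ler_wpM2r// lerDr ltW.
have [yA|Ay] := leP y A.
  apply: (le_trans (scaled_le smono s0 g0 x0 xy (xAe _ yA))).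
  by rewrite ler_wpM2l ?(ltW Ae0)// ler_peMl.
apply: (le_trans (scaled_le smono s0 g0 x0 (ltW xA) (xAe _ (lexx _)))).
rewrite ler_wpM2l ?(ltW Ae0)//; apply: (le_trans (HM _ _ (lexx _) (ltW Ay))).
by rewrite ler_wpM2r// le_max lexx orbT.
Qed.

(** With [K ^ d = q], the factor [q ^ n] is exactly the growth of [x ^ d] from [t] to [K ^ n * t],
    so the hypothesis says that [scaled s (b + d)] is almost increasing along powers of [K]. Points
    in between cost one more factor [K ^ (b + d)]. *)
Lemma grows_above_of_geometric s b K q T M :
  (forall x y, 0 <= x -> x <= y -> s x <= s y) ->
  (forall x, 0 <= x -> 0 <= s x) ->
  0 <= b -> 1 < K -> 1 < q -> 0 < T -> 0 < M ->
  (forall n t, T <= t ->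
     scaled s b t * q ^+ n <= M * scaled s b (K ^+ n * t)) ->
  grows_above s b.
Proof.
move=> smono s0 b0 K1 q1 T0 M0 H.
have K0 : 0 < K by lra.
have lnK0 : 0 < ln K by rewrite ln_gt0.
have [d d0 Kd] : exists2 d, 0 < d & K `^ d = q.
  exists (ln q / ln K); first by rewrite divr_gt0// ln_gt0.
  by rewrite /powR gt_eqF// mulfVK ?gt_eqF// lnK// posrE; lra.
exists (b + d); split; first by rewrite ltrDl.
exists T; split=> //; exists (M * K `^ (b + d)).
split; first by rewrite mulr_gt0 ?powR_gt0.
move=> x y Tx xy.
have x0 : 0 < x by exact: lt_le_trans Tx.
have : exists n, y < K ^+ n * x.
  by have [n] := ltr_expn_ex (y / x) K1; rewrite ltr_pdivrMr//; exists n.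
(* The least exponent is not 0 because [x <= y]; its predecessor [n] satisfies
   [K ^ n * x <= y < K ^ n.+1 * x]. *)
move=> /ex_minnP[[|n]]; first by rewrite expr0 mul1r ltNge xy.
move=> yn /(_ n)/contraNN; rewrite ltnn -leNgt => /(_ isT) ny.
have Kn0 : 0 < K ^+ n by exact: exprn_gt0.
have z0 : 0 < K ^+ n * x by rewrite mulr_gt0.
have := H n x Tx; rewrite -(scaledD _ _ d x0) -(scaledD _ _ d z0).
rewrite -Kd powR_exprAC ?(ltW K0)//.
rewrite powRM ?(ltW Kn0) ?(ltW x0)// -mulrA (mulrC (x `^ d)) [leRHS]mulrA.
rewrite ler_pM2r ?mulr_gt0 ?powR_gt0// => /le_trans; apply.
rewrite -mulrA ler_wpM2l ?(ltW M0)//; apply: scaled_le => //.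
  by rewrite addr_ge0// ltW.
by rewrite mulrA -exprS ltW.
Qed.

(** A real [t >= 1] is rounded up to an integer [p] with [t <= p <= k * t]. Then [k ^ n * p] is at
    most [k ^ n.+1 * t] and within ratio [k] of it, so only one geometric step is given up. *)
Lemma grows_above_of_nat_geometric s b (k : nat) q (P : nat) M :
  (forall x y, 0 <= x -> x <= y -> s x <= s y) ->
  (forall x, 0 <= x -> 0 <= s x) ->
  0 <= b -> (1 < k)%N -> 1 < q -> (0 < P)%N -> 0 < M ->
  (forall n p, (P <= p)%N ->
     scaled s b p%:R * q ^+ n <= M * scaled s b (k ^ n * p)%:R) ->
  grows_above s b.
Proof.
move=> smono s0 b0 k1 q1 P0 M0 H.
have k1R : 1 < k%:R :> R by rewrite ltr1n.
have kb0 : 0 < (k%:R : R) `^ b by rewrite powR_gt0; lra.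
(* In this constant [q] pays for the lost step and the two powers [k ^ b] for two uses of
   [scaled_le]; the maximum with 1 settles [n = 0]. *)
have max1 : 1 <= Num.max 1 (q * (k%:R `^ b * (M * k%:R `^ b))) by rewrite le_max lexx.
apply: (@grows_above_of_geometric s b k%:R q P%:R
  (Num.max 1 (q * (k%:R `^ b * (M * k%:R `^ b))))) => //.
- by rewrite ltr0n.
- by lra.
move=> n t Pt.
have t1 : 1 <= t by apply: le_trans Pt; rewrite ler1n.
have t0 : 0 < t by lra.
case: n => [|n].
  by rewrite !expr0 mul1r mulr1 ler_peMl// scaled_ge0// ltW.
pose p := (Num.truncn t).+1.
have tp : t <= p%:R by rewrite ltW// truncnS_gt.
have pt : p%:R <= k%:R * t.
  have -> : p%:R = (Num.truncn t)%:R + 1 :> R by rewrite natr1.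
  apply: (@le_trans _ _ (2 * t)); first by have := truncn_le t; rewrite (ltW t0); lra.
  by rewrite ler_wpM2r ?(ltW t0)// ler_nat.
have p0 : 0 < p%:R :> R by rewrite ltr0n.
have Pp : (P <= p)%N by rewrite -(ler_nat R) (le_trans Pt).
have tpb : scaled s b t <= k%:R `^ b * scaled s b p%:R by exact: scaled_le.
have kn0 : 0 < k%:R ^+ n :> R by rewrite exprn_gt0; lra.
have kn : scaled s b (k ^ n * p)%:R <= k%:R `^ b * scaled s b (k%:R ^+ n.+1 * t).
  rewrite natrM natrX; apply: scaled_le => //.
  - by rewrite mulr_gt0.
  - by rewrite exprSr -mulrA ler_pM2l.
  - by rewrite exprS -mulrA ler_pM2l ?ler_pM2l//; lra.
have qn0 : 0 < q ^+ n by rewrite exprn_gt0; lra.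
have q0 : 0 < q by lra.
apply: (@le_trans _ _ (q * (k%:R `^ b * (M * k%:R `^ b)) *
    scaled s b (k%:R ^+ n.+1 * t))); last first.
  rewrite ler_wpM2r ?le_max ?lexx ?orbT// scaled_ge0//.
  by rewrite mulr_ge0 ?exprn_ge0 ?(ltW t0)//; lra.
apply: (@le_trans _ _ (q * (k%:R `^ b * (scaled s b p%:R * q ^+ n)))).
  by rewrite exprS mulrCA ler_pM2l// mulrA ler_pM2r.
rewrite -[leRHS]mulrA ler_pM2l// -[leRHS]mulrA ler_pM2l// -mulrA.
by apply: (le_trans (H n p Pp)); rewrite ler_pM2l.
Qed.

(** Let S be [scaled s (b + d)]. Then [H(x) = S(x) x^d <= M S(y) x^d], while [y >= k x] gives
    [y^d >= k^d x^d]; any [k] with [k^d >= M / th] absorbs [M]. *)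
Lemma grows_above_ratio s b e th :
  (forall x y, 0 <= x -> x <= y -> s x <= s y) ->
  (forall x, 0 <= x -> 0 <= s x) -> 0 <= b ->
  grows_above s b -> 0 < e -> 0 < th ->
  exists k, (2 <= k)%N /\ forall x y, e <= x -> k%:R * x <= y ->
    scaled s b x <= th * scaled s b y.
Proof.
move=> smono s0 b0 [g [bg [A [A0 gA]]]] e0 th0.
have g0 : 0 <= g by lra.
have {gA A A0} [M [M0 HM]] := almost_increasing_extend smono s0 g0 A0 e0 gA.
have gE : g = b + (g - b) by lra.
set d := g - b in gE; have d0 : 0 < d by rewrite subr_gt0.
have [k [k2 rk]] := powR_nat_ge (M / th) d0.
exists k; split=> // x y ex kxy.
have x0 : 0 < x by exact: lt_le_trans ex.
have k0 : 0 < k%:R :> R by rewrite ltr0n (leq_trans _ k2).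
have k1 : 1 <= k%:R :> R by rewrite ler1n ltnW.
have xy : x <= y by apply: le_trans kxy; rewrite ler_peMl// ltW.
have y0 : 0 < y by exact: lt_le_trans xy.
have kd : M <= th * k%:R `^ d by rewrite mulrC -ler_pdivrMr// rk.
have := HM _ _ ex xy; rewrite gE => h.
rewrite -(scaledD _ _ d x0) -(scaledD _ _ d y0).
have S0 := scaled_ge0 (b + d) s0 (ltW y0).
apply: (@le_trans _ _ (M * scaled s (b + d) y * x `^ d)).
  by rewrite ler_wpM2r ?powR_ge0.
apply: (@le_trans _ _ (th * k%:R `^ d * scaled s (b + d) y * x `^ d)).
  by rewrite ler_wpM2r ?powR_ge0// ler_wpM2r.
rewrite [leLHS](_ : _ = th * (scaled s (b + d) y * (k%:R * x) `^ d)); last first.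
  by rewrite powRM ?(ltW x0) ?(ltW k0)//; ring.
rewrite ler_pM2l// ler_wpM2l//.
by rewrite ge0_ler_powR ?nnegrE ?(ltW d0) ?(ltW y0)// mulr_ge0// ltW.
Qed.

(** The bound [F n <= C * h n] makes the increment [c * h n] at least the fraction [c / C] of [F n].
    So [F] grows geometrically from [F 1 >= c * h 0], and the same bound passes the growth on to
    [h]. *)
Lemma geometric_of_sums (F h : nat -> R) c C :
  0 < c -> 0 < C -> (forall n, 0 <= F n) ->
  (forall n, F n <= C * h n) -> (forall n, F n + c * h n <= F n.+1) ->
  forall n, h 0%N * (1 + c / C) ^+ n <= (1 + C / c) * h n.
Proof.
move=> c0 C0 F0 FC Fc.
have h0 n : 0 <= h n by rewrite -(pmulr_rge0 _ C0) (le_trans (F0 n)).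
have q0 : 0 < 1 + c / C by rewrite addr_gt0// divr_gt0.
case=> [|n].
  by rewrite expr0 mulr1 mulrDl mul1r lerDl mulr_ge0// divr_ge0// ltW.
have grow m : (1 + c / C) * F m <= F m.+1.
  apply: le_trans (Fc m); rewrite mulrDl mul1r lerD2l -mulrA ler_pM2l//.
  by rewrite mulrC ler_pdivrMr// mulrC.
have Fn : (1 + c / C) ^+ n * (c * h 0%N) <= F n.+1.
  elim: n => [|n IH]; first by rewrite expr0 mul1r (le_trans _ (Fc 0%N))// lerDr.
  by rewrite exprS -mulrA (le_trans _ (grow _))// ler_pM2l.
have H := le_trans Fn (FC n.+1); rewrite exprS.
(* The growth of [F] starts at index 1, so one factor of the rate is missing; the constant makes up
   for it. *)
have -> : (1 + C / c) = (1 + c / C) * (C / c) by field; rewrite !gt_eqF.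
rewrite mulrCA -[leRHS]mulrA ler_pM2l// mulrAC ler_pdivlMr//.
by apply: le_trans H; rewrite [leLHS](_ : _ = (1 + c / C) ^+ n * (c * h 0%N))//; ring.
Qed.

(** The mirror image: [T n >= (1 + c / C) * T n.+1], so [T] decays geometrically from
    [T 0 <= C * g 0], and [c * g n.+1 <= T n] carries the decay over to [g]. *)
Lemma geometric_of_tails (T g : nat -> R) c C :
  0 < c -> 0 < C -> (forall n, 0 <= T n) ->
  (forall n, T n <= C * g n) -> (forall n, T n.+1 + c * g n.+1 <= T n) ->
  forall n, g n * (1 + c / C) ^+ n <= (1 + C / c) * g 0%N.
Proof.
move=> c0 C0 T0 TC Tc.
have g0 n : 0 <= g n by rewrite -(pmulr_rge0 _ C0) (le_trans (T0 n)).
have q0 : 0 < 1 + c / C by rewrite addr_gt0// divr_gt0.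
case=> [|n].
  by rewrite expr0 mulr1 mulrDl mul1r lerDl mulr_ge0// divr_ge0// ltW.
have grow m : (1 + c / C) * T m.+1 <= T m.
  apply: le_trans (Tc m); rewrite mulrDl mul1r lerD2l -mulrA ler_pM2l//.
  by rewrite mulrC ler_pdivrMr// mulrC.
have Tn : (1 + c / C) ^+ n * T n <= C * g 0%N.
  elim: n => [|n IH]; first by rewrite expr0 mul1r.
  by rewrite exprSr -mulrA (le_trans _ IH)// ler_wpM2l// exprn_ge0// ltW.
have cg : c * g n.+1 <= T n by rewrite (le_trans _ (Tc n))// lerDr.
have H : (1 + c / C) ^+ n * (c * g n.+1) <= C * g 0%N.
  by apply: le_trans Tn; rewrite ler_wpM2l// exprn_ge0// ltW.
have -> : (1 + C / c) = (1 + c / C) * (C / c) by field; rewrite !gt_eqF.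
rewrite exprS mulrCA -[leRHS]mulrA ler_pM2l// mulrAC ler_pdivlMr//.
by apply: le_trans H; rewrite [leLHS](_ : _ = (1 + c / C) ^+ n * (c * g n.+1))//; ring.
Qed.

End Growth.

(** * Dyadic blocks *)

Section Blocks.
Variables (R : realType) (s : R -> R) (b : R).
Hypothesis smono : forall x y : R, 0 <= x -> x <= y -> s x <= s y.
Hypothesis s0 : forall x : R, 0 <= x -> 0 <= s x.
Hypothesis b0 : 0 <= b.

Lemma scaledV x : x `^ b / s x = (scaled s b x)^-1.
Proof. by rewrite invf_div. Qed.

Lemma scaled_gt0 x : 0 < x -> 0 < s x -> 0 < scaled s b x.
Proof. by move=> x0 sx; rewrite divr_gt0// powR_gt0. Qed.

Lemma scaled_div y : 0 < y -> scaled s b y / y = s y / y `^ (b + 1).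
Proof. by move=> y0; rewrite powRD_gt0// powRr1 ?ltW// invfM mulrA. Qed.

(** Here [head] refers to the integrand of (i) and the terms of (x), [tail] to those of (vi) and
    (vii). The bound has the form H(y) / y so that a block of length at most [y] contributes at most
    a multiple of H(y). *)
Lemma head_le K z t y : 0 < z -> z <= t -> t <= y -> y <= K * z ->
  s t / t `^ (b + 1) <= K `^ (b + 1) * scaled s b y / y.
Proof.
move=> z0 zt ty yKz.
have t0 : 0 < t by exact: lt_le_trans zt.
have y0 : 0 < y by exact: lt_le_trans ty.
have K0 : 0 < K by rewrite -(pmulr_lgt0 _ z0) (lt_le_trans y0).
rewrite -mulrA scaled_div// ler_pdivrMr ?powR_gt0//.
rewrite [leRHS](_ : _ = (K * t) `^ (b + 1) / y `^ (b + 1) * s y); last first.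
  by rewrite powRM ?(ltW K0) ?(ltW t0)//; ring.
apply: (le_trans (smono (ltW t0) ty)).
rewrite ler_peMl ?s0 ?(ltW y0)// ler_pdivlMr ?powR_gt0// mul1r.
rewrite ge0_ler_powR ?nnegrE ?addr_ge0 ?mulr_ge0 ?(ltW y0) ?(ltW K0) ?(ltW t0)//.
by rewrite (le_trans yKz)// ler_pM2l.
Qed.

Lemma head_ge t y : 0 < y -> y <= t -> t <= 2 * y ->
  (2 `^ (b + 1))^-1 * scaled s b y / y <= s t / t `^ (b + 1).
Proof.
move=> y0 yt t2y.
have t0 : 0 < t by exact: lt_le_trans yt.
rewrite -mulrA scaled_div// mulrCA -invfM -powRM ?(ltW y0)//.
rewrite ler_pM ?s0 ?invr_ge0 ?powR_ge0 ?(ltW y0)//; first exact/smono/yt/ltW.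
rewrite lef_pV2 ?posrE ?powR_gt0 ?mulr_gt0// ge0_ler_powR//.
- exact: addr_ge0.
- by rewrite nnegrE ltW.
- by rewrite nnegrE mulr_ge0// ltW.
Qed.

(** The sign of [b - 1] is unknown, so [t ^ (b - 1)] is split as [t ^ b * t^-1]: the first factor is
    at most [(K * z) ^ b], the second at most [K / y]. *)
Lemma tail_le K z t y : 0 < z -> 0 < s z -> z <= t -> t <= y -> y <= K * z ->
  t `^ (b - 1) / s t <= K `^ (b + 1) * (z `^ b / s z) / y.
Proof.
move=> z0 sz zt ty yKz.
have t0 : 0 < t by exact: lt_le_trans zt.
have y0 : 0 < y by exact: lt_le_trans ty.
have K0 : 0 < K by rewrite -(pmulr_lgt0 _ z0) (lt_le_trans y0).
have st : 0 < s t by rewrite (lt_le_trans sz)// smono// ltW.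
rewrite [leRHS](_ : _ = (K * z) `^ b * (K / y) / s z); last first.
  rewrite powRM ?(ltW K0) ?(ltW z0)// powRD_gt0// powRr1 ?ltW//.
  by field; rewrite !gt_eqF.
rewrite powRD_gt0// powR_inv1 ?(ltW t0)//.
have Vt : t^-1 <= K / y.
  rewrite ler_pdivlMr// mulrC ler_pdivrMr//.
  by rewrite (le_trans yKz)// ler_pM2l.
apply: ler_pM.
- by rewrite mulr_ge0 ?powR_ge0// invr_ge0 ltW.
- by rewrite invr_ge0 ltW.
- apply: ler_pM; rewrite ?powR_ge0 ?invr_ge0 ?(ltW t0)//.
  rewrite ge0_ler_powR ?nnegrE ?(ltW t0) ?mulr_ge0 ?(ltW K0) ?(ltW z0)//.
  exact: le_trans ty yKz.
- by rewrite lef_pV2 ?posrE// smono// ltW.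
Qed.

(** The same splitting from below: [t ^ b >= y ^ b], [t^-1 >= (2 * y)^-1] and [s t <= s (2 * y)].
    The constant rewrites the product of these bounds in terms of 1/H at [2 * y]. *)
Lemma tail_ge t y : 0 < y -> 0 < s t -> y <= t -> t <= 2 * y ->
  (2 `^ (b + 1))^-1 * ((2 * y) `^ b / s (2 * y)) / y <= t `^ (b - 1) / s t.
Proof.
move=> y0 st yt t2y.
have t0 : 0 < t by exact: lt_le_trans yt.
have s2y : 0 < s (2 * y) by rewrite (lt_le_trans st)// smono// ltW.
rewrite [leLHS](_ : _ = y `^ b * (2 * y)^-1 / s (2 * y)); last first.
  rewrite powRM ?(ltW y0)// powRD_gt0// powRr1//.
  by field; rewrite !gt_eqF// powR_gt0.
rewrite powRD_gt0// powR_inv1 ?(ltW t0)//.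
apply: ler_pM; rewrite ?mulr_ge0 ?powR_ge0 ?invr_ge0 ?mulr_ge0 ?(ltW y0) ?(ltW s2y)//.
  apply: ler_pM; rewrite ?powR_ge0 ?invr_ge0 ?mulr_ge0 ?(ltW y0)//.
    by rewrite ge0_ler_powR ?nnegrE ?(ltW y0) ?(ltW t0).
  by rewrite lef_pV2 ?posrE ?mulr_gt0.
by rewrite lef_pV2 ?posrE// smono// ltW.
Qed.

(** * Integrals over intervals and measurability *)

Local Notation mu := (@lebesgue_measure R).

(** The right bound [c] is generic, to cover bounded intervals and half-lines at once; the shared
    point [y] is a null set. *)
Lemma ge0_integral_split (f : R -> \bar R) (x y : R) (c : itv_bound R) :
  x <= y -> (BRight y <= c)%O ->
  measurable_fun [set` Interval (BLeft x) c] f ->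
  (forall t, x <= t -> (0 <= f t)%E) ->
  (\int[mu]_(t in [set` Interval (BLeft x) c]) f t =
   \int[mu]_(t in `[x, y]) f t + \int[mu]_(t in [set` Interval (BLeft y) c]) f t)%E.
Proof.
move=> xy yc mf f0.
have E : [set` Interval (BLeft x) c] = `[x, y] `|` [set` Interval (BRight y) c].
  by apply: itv_bndbnd_setU => //; rewrite bnd_simp.
rewrite E ge0_integral_setU//=.
- rewrite integral_itv_obnd_cbnd//; apply: measurable_funS mf => //.
  by rewrite E; exact: subsetUr.
- by rewrite -E.
- move=> t [|]/=; rewrite in_itv/= => /andP[h _]; apply: f0 => //.
  by rewrite (le_trans xy)// ltW.
- rewrite disj_set2E; apply/eqP/seteqP; split=> // t [] /=; rewrite !in_itv/=.
  by move=> /andP[_ ty] /andP[yt _]; move: (le_lt_trans ty yt); rewrite ltxx.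
Qed.

Lemma integral_itv_ge (f : R -> R) (m x y : R) : x <= y -> 0 <= m ->
  measurable_fun `[x, y] f -> (forall t, x <= t -> t <= y -> m <= f t) ->
  ((m * (y - x))%:E <= \int[mu]_(t in `[x, y]) (f t)%:E)%E.
Proof.
move=> xy m0 mf mft.
have -> : ((m * (y - x))%:E = \int[mu]_(t in `[x, y]) cst m%:E t)%E.
  rewrite integral_cst//= lebesgue_measure_itv/= lte_fin.
  have [//|yx] := ltP x y; have yE : y = x by apply/le_anti/andP.
  by rewrite yE subrr mulr0 mule0.
apply: ge0_le_integral; [by []|by []|exact: measurable_cst|exact/measurable_EFinP|].
by move=> t; rewrite /= in_itv/= => /andP[xt ty]; rewrite lee_fin mft.
Qed.

Lemma integral_itv_le (f : R -> R) (m x y : R) : x <= y ->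
  measurable_fun `[x, y] f -> (forall t, x <= t -> 0 <= f t) ->
  (forall t, x <= t -> t <= y -> f t <= m) ->
  (\int[mu]_(t in `[x, y]) (f t)%:E <= (m * (y - x))%:E)%E.
Proof.
move=> xy mf f0 mft.
have -> : ((m * (y - x))%:E = \int[mu]_(t in `[x, y]) cst m%:E t)%E.
  rewrite integral_cst//= lebesgue_measure_itv/= lte_fin.
  have [//|yx] := ltP x y; have yE : y = x by apply/le_anti/andP.
  by rewrite yE subrr mulr0 mule0.
apply: ge0_le_integral; [by []| |exact/measurable_EFinP|exact: measurable_cst|].
  by move=> t; rewrite /= in_itv/= => /andP[xt ty]; rewrite lee_fin f0.
by move=> t; rewrite /= in_itv/= => /andP[xt ty]; rewrite lee_fin mft.
Qed.

(** [s] is monotone only on [[0, +oo[]; [s (Num.max x t)] is monotone in [t] on the whole line and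
    agrees with [s t] on [D]. *)
Lemma measurable_mono x (D : set R) :
  measurable D -> 0 <= x -> D `<=` `[x, +oo[%classic -> measurable_fun D s.
Proof.
move=> mD x0 Dx; apply: (@eq_measurable_fun _ _ _ _ _ (fun t => s (Num.max x t))).
  move=> t; rewrite inE => /Dx/=; rewrite in_itv/= andbT => xt.
  by rewrite max_r.
apply: nondecreasing_measurable => // u v uv; apply: smono.
  by rewrite le_max x0.
by rewrite ge_max !le_max lexx uv orbT.
Qed.

(** The same truncation keeps [s] positive, so the reciprocal is monotone on the whole line too. *)
Lemma measurable_monoV x (D : set R) :
  measurable D -> 0 <= x -> 0 < s x -> D `<=` `[x, +oo[%classic ->
  measurable_fun D (fun t => (s t)^-1).
Proof.
move=> mD x0 sx Dx.
apply: (@eq_measurable_fun _ _ _ _ _ (fun t => (s (Num.max x t))^-1)).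
  move=> t; rewrite inE => /Dx/=; rewrite in_itv/= andbT => xt.
  by rewrite max_r.
have sm t : 0 < s (Num.max x t).
  by rewrite (lt_le_trans sx)// smono// le_max lexx.
apply: nonincreasing_measurable => // u v uv; rewrite lef_pV2 ?posrE//; apply: smono.
  by rewrite le_max x0.
by rewrite ge_max !le_max lexx uv orbT.
Qed.

Lemma measurable_head x (D : set R) :
  measurable D -> 0 <= x -> D `<=` `[x, +oo[%classic ->
  measurable_fun D (fun t => s t / t `^ (b + 1)).
Proof.
move=> mD x0 Dx; apply: measurable_funM; first exact: measurable_mono Dx.
apply: (@eq_measurable_fun _ _ _ _ _ (fun t => t `^ (- (b + 1)))).
  by move=> t _; rewrite powRN.
by apply: measurable_funTS; exact: measurable_powR.
Qed.

Lemma measurable_tail x (D : set R) :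
  measurable D -> 0 <= x -> 0 < s x -> D `<=` `[x, +oo[%classic ->
  measurable_fun D (fun t => t `^ (b - 1) / s t).
Proof.
move=> mD x0 sx Dx; apply: measurable_funM; last exact: measurable_monoV Dx.
by apply: measurable_funTS; exact: measurable_powR.
Qed.

End Blocks.

(** * Upper bounds for heads and tails *)

Section UpperBounds.
Variables (R : realType) (s : R -> R) (b : R).
Hypothesis smono : forall x y : R, 0 <= x -> x <= y -> s x <= s y.
Hypothesis s0 : forall x : R, 0 <= x -> 0 <= s x.
Hypothesis b0 : 0 <= b.
Local Notation mu := (@lebesgue_measure R).

Lemma head_ge0 t : 0 <= t -> 0 <= s t / t `^ (b + 1).
Proof. by move=> t0; rewrite divr_ge0 ?powR_ge0 ?s0. Qed.

Lemma tail_ge0 t : 0 <= t -> 0 <= t `^ (b - 1) / s t.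
Proof. by move=> t0; rewrite divr_ge0 ?powR_ge0 ?s0. Qed.

Lemma head_integral_split (x y z : R) : 0 <= x -> x <= y -> y <= z ->
  (\int[mu]_(t in `[x, z]) (s t / t `^ (b + 1))%:E =
   \int[mu]_(t in `[x, y]) (s t / t `^ (b + 1))%:E +
   \int[mu]_(t in `[y, z]) (s t / t `^ (b + 1))%:E)%E.
Proof.
move=> x0 xy yz; apply: ge0_integral_split => //.
- apply/measurable_EFinP; apply: (measurable_head b smono _ x0) => // t /=.
  by rewrite !in_itv/= => /andP[->].
- by move=> t xt; rewrite lee_fin head_ge0// (le_trans x0).
Qed.

Lemma head_integral_block_le (K x y : R) : 0 < x -> x <= y -> y <= K * x ->
  (\int[mu]_(t in `[x, y]) (s t / t `^ (b + 1))%:E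
     <= (K `^ (b + 1) * scaled s b y)%:E)%E.
Proof.
move=> x0 xy yKx; have y0 := lt_le_trans x0 xy.
have K0 : 0 <= K `^ (b + 1) * scaled s b y.
  by rewrite mulr_ge0 ?powR_ge0// scaled_ge0// ltW.
apply: (@le_trans _ _ (K `^ (b + 1) * scaled s b y / y * (y - x))%:E).
  apply: integral_itv_le => //.
  - apply: (measurable_head b smono _ (ltW x0)) => // t /=.
    by rewrite !in_itv/= => /andP[->].
  - by move=> t xt; rewrite head_ge0// (le_trans (ltW x0)).
  - by move=> t xt ty; exact: head_le xt ty yKx.
rewrite lee_fin -mulrA ler_piMr// mulrC ler_pdivrMr// mul1r.
by rewrite lerBlDr lerDl ltW.
Qed.

Lemma head_integral_le : grows_above s b ->
  exists C : R, 0 < C /\ forall y : R, 1 <= y ->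
    (\int[mu]_(t in `[1%R, y]) (s t / t `^ (b + 1))%:E <= (C * scaled s b y)%:E)%E.
Proof.
move=> gr; have h0 : 0 < 2^-1 :> R by rewrite invr_gt0.
have [k [k2 ratio]] := grows_above_ratio smono s0 b0 gr ltr01 h0.
have k0 : 0 < k%:R :> R by rewrite ltr0n (leq_trans _ k2).
have k1 : 1 < k%:R :> R by rewrite ltr1n.
have Kb : 0 < k%:R `^ (b + 1) :> R by rewrite powR_gt0.
exists (2 * k%:R `^ (b + 1)); split; first by rewrite mulr_gt0.
(* Writing I for the integral and C for [2 k^(b + 1)],
   I(y) <= I(y/k) + (C/2) H(y) and I(y/k) <= C H(y/k) <= (C/2) H(y). *)
suff main n (y : R) : 1 <= y -> y <= k%:R ^+ n ->
    (\int[mu]_(t in `[1%R, y]) (s t / t `^ (b + 1))%:E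
      <= (2 * k%:R `^ (b + 1) * scaled s b y)%:E)%E.
  by move=> y y1; have [n /ltW] := ltr_expn_ex y k1; exact: main.
elim: n y => [|n IH] y y1 yk.
  apply: (le_trans (head_integral_block_le (K := k%:R) ltr01 y1 _)).
    by rewrite mulr1 (le_trans yk)// expr0 ltW.
  rewrite lee_fin ler_wpM2r ?scaled_ge0//; lra.
have [yk1|ky] := leP y k%:R.
  apply: (le_trans (head_integral_block_le (K := k%:R) ltr01 y1 _)).
    by rewrite mulr1.
  rewrite lee_fin ler_wpM2r ?scaled_ge0//; lra.
have yk1 : 1 <= y / k%:R by rewrite ler_pdivlMr// mul1r ltW.
have yky : y / k%:R <= y by rewrite ler_pdivrMr// ler_peMr; lra.
rewrite (head_integral_split _ yk1)//.
have ykn : y / k%:R <= k%:R ^+ n by rewrite ler_pdivrMr// -exprSr.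
have B := @head_integral_block_le k%:R (y / k%:R) y.
apply: (le_trans (leeD (IH _ yk1 ykn) (B _ yky _))).
- by rewrite divr_gt0//; lra.
- by rewrite mulrC divfK ?gt_eqF.
rewrite -EFinD lee_fin.
have := ratio (y / k%:R) y yk1; rewrite mulrC divfK ?gt_eqF// => /(_ (lexx _)).
rewrite -(ler_pM2l Kb); lra.
Qed.

(** The recursion of [head_integral_le] on integers: strong induction from [p] to the quotient
    [p %/ k], each of the two parts taking half of the constant. *)
Lemma head_sum_le : grows_above s b ->
  exists C : R, 0 < C /\ forall p : nat, (1 <= p)%N ->
    \sum_(1 <= k < p.+1) s k%:R / k%:R `^ (1 + b) <= C * scaled s b p%:R.
Proof.
move=> gr; have h0 : 0 < 2^-1 :> R by rewrite invr_gt0.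
have [k [k2 ratio]] := grows_above_ratio smono s0 b0 gr ltr01 h0.
have k0 : 0 < k%:R :> R by rewrite ltr0n (leq_trans _ k2).
have Kb : 0 < k%:R `^ (b + 1) :> R by rewrite powR_gt0.
exists (2 * k%:R `^ (b + 1)); split; first by rewrite mulr_gt0.
elim/ltn_ind => p IH p1; have p0 : 0 < p%:R :> R by rewrite ltr0n.
have qp : (p %/ k < p)%N by rewrite ltn_Pdiv.
rewrite (big_cat_nat (n := (p %/ k).+1))//=; last by rewrite ltnS ltnW.
have Hp := scaled_ge0 b s0 (ltW p0).
have hi : \sum_((p %/ k).+1 <= j < p.+1) s j%:R / j%:R `^ (1 + b)
    <= k%:R `^ (b + 1) * scaled s b p%:R.
  have -> : k%:R `^ (b + 1) * scaled s b p%:R =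
      \sum_(0 <= j < p) k%:R `^ (b + 1) * scaled s b p%:R / p%:R.
    by rewrite sumr_const_nat subn0 -[RHS]mulr_natr divfK ?gt_eqF.
  apply: (@le_trans _ _ (\sum_((p %/ k).+1 <= j < p.+1)
      k%:R `^ (b + 1) * scaled s b p%:R / p%:R)).
    apply: ler_sum_nat => j /andP[qj]; rewrite ltnS addrC => jp.
    (* The block starts at [(p %/ k).+1] and [p < k * (p %/ k).+1], so its terms stay within ratio
       [k] of [p]. *)
    apply: (@head_le _ _ _ smono s0 b0 _ (p %/ k).+1%:R); rewrite ?ler_nat ?ltr0n//.
    by rewrite -natrM ler_nat mulnC ltnW// ltn_ceil// (leq_trans _ k2).
  rewrite !sumr_const_nat ler_wpMn2l ?subn0 ?subSS ?leq_subr//.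
  by rewrite divr_ge0 ?(ltW p0)// mulr_ge0// ltW.
apply: (@le_trans _ _ (k%:R `^ (b + 1) * scaled s b p%:R +
    k%:R `^ (b + 1) * scaled s b p%:R)); last lra.
apply: lerD => //.
have [q0|q0] := posnP (p %/ k).
  by rewrite q0 big_geq// mulr_ge0// ltW.
apply: (le_trans (IH _ qp q0)).
rewrite -mulrA mulrCA ler_pM2l//.
have := ratio (p %/ k)%:R p%:R; rewrite ler1n -natrM ler_nat mulnC leq_divM.
by move=> /(_ q0 isT); lra.
Qed.

Lemma tail_integral_split (x y : R) (c : itv_bound R) :
  0 <= x -> 0 < s x -> x <= y -> (BRight y <= c)%O ->
  (\int[mu]_(t in [set` Interval (BLeft x) c]) (t `^ (b - 1) / s t)%:E =
   \int[mu]_(t in `[x, y]) (t `^ (b - 1) / s t)%:E +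
   \int[mu]_(t in [set` Interval (BLeft y) c]) (t `^ (b - 1) / s t)%:E)%E.
Proof.
move=> x0 sx xy yz; apply: ge0_integral_split => //.
- apply/measurable_EFinP; apply: (measurable_tail b smono _ x0) => // t /=.
  by rewrite !in_itv/= => /andP[->].
- by move=> t xt; rewrite lee_fin tail_ge0// (le_trans x0).
Qed.

Lemma tail_integral_block_le (K x : R) : 0 < x -> 0 < s x -> 1 <= K ->
  (\int[mu]_(t in `[x, (K * x)%R]) (t `^ (b - 1) / s t)%:E
     <= (K `^ (b + 1) * (x `^ b / s x))%:E)%E.
Proof.
move=> x0 sx K1; have xKx : x <= K * x by rewrite ler_peMl// ltW.
have y0 := lt_le_trans x0 xKx.
have K0 : 0 <= K `^ (b + 1) * (x `^ b / s x).
  by rewrite mulr_ge0 ?powR_ge0// mulr_ge0 ?powR_ge0// invr_ge0 ltW.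
apply: (@le_trans _ _ (K `^ (b + 1) * (x `^ b / s x) / (K * x) * (K * x - x))%:E).
  apply: integral_itv_le => //.
  - apply: (measurable_tail b smono _ (ltW x0)) => // t /=.
    by rewrite !in_itv/= => /andP[->].
  - by move=> t xt; rewrite tail_ge0// (le_trans (ltW x0)).
  - by move=> t xt ty; exact: tail_le xt ty _.
rewrite lee_fin -mulrA ler_piMr// mulrC ler_pdivrMr// mul1r.
by rewrite lerBlDr lerDl ltW.
Qed.

(** As [x ^ b / s x] is 1/H(x), the doubling of H over a factor [k] becomes a halving here. *)
Lemma tail_ratio (k : nat) (e : R) : 0 < e -> 0 < s e -> (1 < k)%N ->
  (forall x y, e <= x -> k%:R * x <= y -> scaled s b x <= 2^-1 * scaled s b y) ->
  forall x, e <= x ->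
    2 * ((k%:R * x) `^ b / s (k%:R * x)) <= x `^ b / s x.
Proof.
move=> e0 se k1 ratio x ex.
have x0 : 0 < x by exact: lt_le_trans ex.
have xkx : x <= k%:R * x by rewrite ler_peMl ?(ltW x0)// ler1n ltnW.
have sx : 0 < s x by rewrite (lt_le_trans se)// smono// ltW.
have skx : 0 < s (k%:R * x) by rewrite (lt_le_trans sx)// smono// ltW.
have Hx : 0 < scaled s b x by exact: scaled_gt0.
have Hkx : 0 < scaled s b (k%:R * x) by apply: scaled_gt0 => //; exact: lt_le_trans xkx.
rewrite !scaledV ler_pdivrMr// mulrC ler_pdivlMr//.
have := ratio x _ ex (lexx _); lra.
Qed.

Lemma tail_integral_le (e : R) : grows_above s b -> 0 < e -> 0 < s e ->
  exists C : R, 0 < C /\ forall y : R, e <= y ->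
    (\int[mu]_(t in `[y, +oo[) (t `^ (b - 1) / s t)%:E <= (C * (y `^ b / s y))%:E)%E.
Proof.
move=> gr e0 se; have h0 : 0 < 2^-1 :> R by rewrite invr_gt0.
have [k [k2 /(tail_ratio e0 se k2) ratio]] := grows_above_ratio smono s0 b0 gr e0 h0.
have k0 : 0 < k%:R :> R by rewrite ltr0n (leq_trans _ k2).
have k1 : 1 < k%:R :> R by rewrite ltr1n.
have Kb : 0 < k%:R `^ (b + 1) :> R by rewrite powR_gt0.
exists (2 * k%:R `^ (b + 1)); split; first by rewrite mulr_gt0.
(* The block [[y, k * y]] uses half of the constant; the induction hypothesis at [k * y] fits in the
   other half by [ratio]. The bound is uniform in [n], so monotone convergence extends it to the
   half-line. *)
have main n (y : R) : e <= y ->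
    (\int[mu]_(t in `[y, (k%:R ^+ n * y)%R]) (t `^ (b - 1) / s t)%:E
      <= (2 * k%:R `^ (b + 1) * (y `^ b / s y))%:E)%E.
  elim: n y => [|n IH] y ey; have y0 : 0 < y by [exact: lt_le_trans ey];
    have sy : 0 < s y by rewrite ?(lt_le_trans se)// smono// ltW.
    rewrite expr0 mul1r set_itv1 integral_set1 lee_fin.
    by rewrite mulr_ge0 ?mulr_ge0 ?invr_ge0 ?powR_ge0 ?(ltW Kb) ?(ltW sy).
  have yky : y <= k%:R * y by rewrite ler_peMl ?(ltW y0) ?(ltW k1).
  rewrite exprSr -mulrA (tail_integral_split (ltW y0) sy yky); last first.
    by rewrite bnd_simp ler_peMl ?exprn_ege1 ?(ltW k1)// mulr_ge0// ltW.
  have B := tail_integral_block_le y0 sy (ltW k1).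
  apply: (le_trans (leeD B (IH _ (le_trans ey yky)))).
  rewrite -EFinD lee_fin; have := ratio y ey; rewrite -(ler_pM2l Kb); lra.
move=> y ey; have y0 : 0 < y by exact: lt_le_trans ey.
have sy : 0 < s y by rewrite (lt_le_trans se)// smono// ltW.
have E : `[y, +oo[%classic = \bigcup_n `[y, (k%:R ^+ n * y)]%classic.
  apply/seteqP; split => [t|t [n _]] /=; rewrite !in_itv/=.
    rewrite andbT => yt; have [n nt] := ltr_expn_ex (t / y) k1.
    by exists n => //=; rewrite in_itv/= yt/= -ler_pdivrMr// ltW.
  by move=> /andP[->].
have mt (D : set R) : measurable D -> D `<=` `[y, +oo[%classic ->
    measurable_fun D (fun t => (t `^ (b - 1) / s t)%:E).
  by move=> mD Dy; apply/measurable_EFinP; exact: (measurable_tail b smono mD (ltW y0)).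
have Fsub n : `[y, (k%:R ^+ n * y)]%classic `<=` `[y, +oo[%classic.
  by move=> t /=; rewrite !in_itv/= => /andP[->].
have cv : (\int[mu]_(t in `[y, (k%:R ^+ n * y)%R]%classic)
      (t `^ (b - 1) / s t)%:E)%E @[n --> \oo] -->
    (\int[mu]_(t in \bigcup_n `[y, (k%:R ^+ n * y)%R]%classic)
      (t `^ (b - 1) / s t)%:E)%E.
  apply: ge0_nondecreasing_set_cvg_integral.
  - move=> n m nm; apply/subsetPset => t /=; rewrite !in_itv/= => /andP[-> tn]/=.
    by rewrite (le_trans tn)// ler_wpM2r ?(ltW y0)// ler_weXn2l// ltW.
  - by move=> n; exact: measurable_itv.
  - by move=> n; apply: mt => //; exact: measurable_itv.
  - move=> n t /Fsub/=; rewrite in_itv/= andbT => yt.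
    by rewrite lee_fin tail_ge0// (le_trans (ltW y0)).
rewrite E -(cvg_lim _ cv)//; apply: lime_le; first exact: cvgP cv.
by apply: nearW => n; exact: main.
Qed.

Lemma tail_sum_le : grows_above s b ->
  exists C : R, 0 < C /\ forall p : nat, (1 <= p)%N -> 0 < s p%:R ->
    (\sum_(p <= k <oo) ((k%:R : R) `^ (b - 1) / s k%:R)%:E
       <= (C * (p%:R `^ b / s p%:R))%:E)%E.
Proof.
move=> gr; have h0 : 0 < 2^-1 :> R by rewrite invr_gt0.
have [k [k2 ratio]] := grows_above_ratio smono s0 b0 gr ltr01 h0.
have k0 : 0 < k%:R :> R by rewrite ltr0n (leq_trans _ k2).
have Kb : 0 < k%:R `^ (b + 1) :> R by rewrite powR_gt0.
exists (2 * k%:R `^ (b + 1)); split; first by rewrite mulr_gt0.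
(* [n] only bounds the length of the range and drives the induction: [p < k * p], so cutting at
   [k * p] shortens the remaining range. *)
have main n p m : (1 <= p)%N -> 0 < s p%:R -> (m <= p + n)%N ->
    \sum_(p <= j < m) (j%:R : R) `^ (b - 1) / s j%:R
      <= 2 * k%:R `^ (b + 1) * (p%:R `^ b / s p%:R).
  elim: n p m => [|n IH] p m p1 sp mp; have p0 : 0 < p%:R :> R by [rewrite ltr0n];
    have G0 : 0 <= p%:R `^ b / s p%:R by [rewrite divr_ge0 ?powR_ge0 ?ltW];
    have C0 : 0 <= k%:R `^ (b + 1) * (p%:R `^ b / s p%:R) by [rewrite mulr_ge0// ltW].
    by rewrite addn0 in mp; rewrite big_geq// -mulrA mulr_ge0.
  have kp0 : 0 < (k * p)%:R :> R by rewrite natrM mulr_gt0.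
  have pkp : (p < k * p)%N by rewrite -{1}[p]mul1n ltn_pmul2r.
  have block m' : (m' <= k * p)%N ->
      \sum_(p <= j < m') (j%:R : R) `^ (b - 1) / s j%:R
        <= k%:R `^ (b + 1) * (p%:R `^ b / s p%:R).
    move=> m'kp; apply: (@le_trans _ _ (\sum_(p <= j < m')
        k%:R `^ (b + 1) * (p%:R `^ b / s p%:R) / (k * p)%:R)).
      apply: ler_sum_nat => j /andP[pj jm].
      apply: (tail_le smono b0 p0) => //; rewrite ?ler_nat -?natrM//.
      by rewrite ltnW// (leq_trans jm).
    rewrite sumr_const_nat -[leLHS]mulr_natr -mulrA ler_piMr//.
    by rewrite mulrC ler_pdivrMr// mul1r ler_nat (leq_trans (leq_subr _ _)).
  have [mkp|kpm] := leqP m (k * p).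
    by apply: (le_trans (block _ mkp)); rewrite -mulrA; lra.
  rewrite (big_cat_nat (n := k * p)); [|exact: ltnW|exact: ltnW].
  have skp : 0 < s (k * p)%:R by rewrite (lt_le_trans sp)// smono// ?ler_nat ltnW.
  have mkp : (m <= k * p + n)%N.
    by apply: (leq_trans mp); rewrite addnS -addSn leq_add2r.
  have kp1 : (1 <= k * p)%N by rewrite (leq_trans p1)// ltnW.
  apply: (le_trans (lerD (block _ (leqnn _)) (IH _ _ kp1 skp mkp))).
  (* The threshold is [p] itself, where [s] is known to be positive; [s] may vanish at 1. *)
  have := @tail_ratio k p%:R p0 sp k2 _ p%:R (lexx _); rewrite -natrM.
  rewrite -(ler_pM2l Kb) => tr; have {}tr := tr _.
  have := tr (fun x y px => ratio x y (le_trans _ px)); rewrite ler1n => /(_ p1); lra.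
move=> p p1 sp; apply: lime_le.
  by apply: is_cvg_nneseries => n _ _; rewrite lee_fin tail_ge0.
near=> m; rewrite sumEFin lee_fin; exact: (main m) _ (leq_addl _ _).
Unshelve. all: by end_near. Qed.

End UpperBounds.

(** * Growth from bounds on heads and tails *)

Section Converses.
Variables (R : realType) (s : R -> R) (b : R).
Hypothesis smono : forall x y : R, 0 <= x -> x <= y -> s x <= s y.
Hypothesis s0 : forall x : R, 0 <= x -> 0 <= s x.
Hypothesis b0 : 0 <= b.
Local Notation mu := (@lebesgue_measure R).

(** Doubling [y] adds the block [[y, 2 * y]], worth at least c H(y) by [head_ge]. Thus
    [geometric_of_sums] applies along [2 ^ m * t], the assumed bound also making the integrals
    finite. *)
Lemma grows_above_of_head_integral (C : R) : 0 < C ->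
  (forall y : R, 1 <= y ->
    (\int[mu]_(t in `[1%R, y]) (s t / t `^ (b + 1))%:E <= (C * scaled s b y)%:E)%E) ->
  grows_above s b.
Proof.
move=> C0 HC; pose c := (2 `^ (b + 1))^-1 : R.
have c0 : 0 < c by rewrite invr_gt0 powR_gt0.
have cC : 0 < c / C by rewrite divr_gt0.
have Cc : 0 < C / c by rewrite divr_gt0.
apply: (@grows_above_of_geometric _ s b 2 (1 + c / C) 1 (1 + C / c)) => //; try lra.
pose I (y : R) := (\int[mu]_(t in `[1%R, y]) (s t / t `^ (b + 1))%:E)%E.
have I0 y : (0 <= I y)%E.
  apply: integral_ge0 => t /=; rewrite in_itv/= => /andP[t1 _].
  by rewrite lee_fin head_ge0// (le_trans ler01).
have Ifin y : 1 <= y -> I y \is a fin_num.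
  by move=> y1; rewrite ge0_fin_numE// (le_lt_trans (HC _ y1))// ltry.
have block y : 1 <= y -> ((c * scaled s b y)%:E <=
    \int[mu]_(t in `[y, (2 * y)%R]) (s t / t `^ (b + 1))%:E)%E.
  move=> y1; have y0 : 0 < y by lra.
  have -> : c * scaled s b y = c * scaled s b y / y * (2 * y - y).
    by field; rewrite gt_eqF.
  apply: integral_itv_ge.
  - by lra.
  - by rewrite divr_ge0 ?(ltW y0)// mulr_ge0 ?(ltW c0)// scaled_ge0// ltW.
  - apply: (measurable_head b smono _ (ltW y0)) => // t /=.
    by rewrite !in_itv/= => /andP[->].
  - by move=> t yt ty; exact: head_ge.
move=> n t t1.
have t2 m : 1 <= 2 ^+ m * t by rewrite (le_trans t1)// ler_peMl ?exprn_ege1//; lra.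
have := @geometric_of_sums _ (fun m => fine (I (2 ^+ m * t)))
  (fun m => scaled s b (2 ^+ m * t)) c C c0 C0 _ _ _ n.
rewrite expr0 mul1r; apply.
- by move=> m; rewrite fine_ge0.
- by move=> m; rewrite -lee_fin fineK ?Ifin//; exact: HC.
- move=> m; rewrite -lee_fin EFinD !fineK ?Ifin// exprS -mulrA /I.
  have m2 : 2 ^+ m * t <= 2 * (2 ^+ m * t) by have := t2 m; lra.
  rewrite (head_integral_split b smono s0 ler01 (t2 m) m2).
  by rewrite leeD2l// block.
Qed.

Lemma grows_above_of_head_sum (C : R) : 0 < C ->
  (forall p : nat, (1 <= p)%N ->
    \sum_(1 <= k < p.+1) s k%:R / k%:R `^ (1 + b) <= C * scaled s b p%:R) ->
  grows_above s b.
Proof.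
move=> C0 HC; pose c := (2 `^ (b + 1))^-1 : R.
have c0 : 0 < c by rewrite invr_gt0 powR_gt0.
have cC : 0 < c / C by rewrite divr_gt0.
have Cc : 0 < C / c by rewrite divr_gt0.
apply: (@grows_above_of_nat_geometric _ s b 2 (1 + c / C) 1 (1 + C / c)) => //; try lra.
move=> n p p1; have p2 m : (0 < 2 ^ m * p)%N by rewrite muln_gt0 expn_gt0.
have := @geometric_of_sums _
  (fun m => \sum_(1 <= k < (2 ^ m * p).+1) s k%:R / k%:R `^ (1 + b))
  (fun m => scaled s b (2 ^ m * p)%:R) c C c0 C0 _ _ _ n.
rewrite expn0 mul1n; apply.
- by move=> m; apply: sumr_ge0 => j _; rewrite addrC head_ge0.
- by move=> m; exact: HC.
move=> m; rewrite expnS -mulnA; set q := (2 ^ m * p)%N.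
have q0 : 0 < q%:R :> R by rewrite ltr0n p2.
have qq : (q <= 2 * q)%N by rewrite leq_pmull.
rewrite (big_cat_nat (n := q.+1) (p := (2 * q).+1)) ?ltnS//= lerD2l.
(* The block from [q + 1] to [2 * q] has exactly [q] terms, so the required amount is spread evenly
   over them. *)
have -> : c * scaled s b q%:R =
    \sum_(q.+1 <= j < (2 * q).+1) c * scaled s b q%:R / q%:R.
  rewrite sumr_const_nat subSS mul2n -addnn addnK -[RHS]mulr_natr divfK//.
  by rewrite gt_eqF.
apply: ler_sum_nat => j /andP[qj]; rewrite ltnS addrC => jq.
by apply: head_ge => //; rewrite -?natrM ler_nat// ltnW.
Qed.

(** Decay of 1/H from [x] to [y] is turned into growth of H. *)
Lemma inv_scaled_geometric (M q x y : R) n : 0 < x -> 0 < s x -> 0 < y -> 0 < s y ->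
  y `^ b / s y * q ^+ n <= M * (x `^ b / s x) ->
  scaled s b x * q ^+ n <= M * scaled s b y.
Proof.
move=> x0 sx y0 sy; rewrite !scaledV.
have Hx : 0 < scaled s b x by exact: scaled_gt0.
have Hy : 0 < scaled s b y by exact: scaled_gt0.
by rewrite ler_pdivlMr// -mulrA mulrC ler_pdivrMr// mulrC.
Qed.

(** Doubling [y] removes from the tail the block [[y, 2 * y]], worth at least c / H(2y) by
    [tail_ge]; [geometric_of_tails] then gives the decay of 1/H. *)
Lemma grows_above_of_tail_integral (C T : R) : 0 < C -> 0 < T -> 0 < s T ->
  (forall y : R, T <= y ->
    (\int[mu]_(t in `[y, +oo[) (t `^ (b - 1) / s t)%:E <= (C * (y `^ b / s y))%:E)%E) ->
  grows_above s b.
Proof.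
move=> C0 T0 sT HC; pose c := (2 `^ (b + 1))^-1 : R.
have c0 : 0 < c by rewrite invr_gt0 powR_gt0.
have cC : 0 < c / C by rewrite divr_gt0.
have Cc : 0 < C / c by rewrite divr_gt0.
apply: (@grows_above_of_geometric _ s b 2 (1 + c / C) T (1 + C / c)) => //; try lra.
pose I (y : R) := (\int[mu]_(t in `[y, +oo[) (t `^ (b - 1) / s t)%:E)%E.
have I0 y : T <= y -> (0 <= I y)%E.
  move=> Ty; apply: integral_ge0 => t /=; rewrite in_itv/= andbT => yt.
  by rewrite lee_fin tail_ge0// (le_trans _ yt)// (le_trans (ltW T0)).
have Ifin y : T <= y -> I y \is a fin_num.
  by move=> y1; rewrite ge0_fin_numE ?I0// (le_lt_trans (HC _ y1))// ltry.
have spos y : T <= y -> 0 < s y.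
  by move=> Ty; rewrite (lt_le_trans sT)// smono// ltW.
have block y : T <= y -> ((c * ((2 * y) `^ b / s (2 * y)))%:E <=
    \int[mu]_(t in `[y, (2 * y)%R]) (t `^ (b - 1) / s t)%:E)%E.
  move=> Ty; have y0 : 0 < y by lra.
  have s2y : 0 < s (2 * y) by apply: spos; lra.
  have -> : c * ((2 * y) `^ b / s (2 * y)) =
      c * ((2 * y) `^ b / s (2 * y)) / y * (2 * y - y).
    by field; rewrite !gt_eqF.
  apply: integral_itv_ge.
  - by lra.
  - by rewrite divr_ge0 ?(ltW y0)// mulr_ge0 ?(ltW c0)// divr_ge0 ?powR_ge0// ltW.
  - apply: (measurable_tail b smono _ (ltW y0)) => //; first exact: spos.
    by move=> t /=; rewrite !in_itv/= => /andP[->].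
  - by move=> t yt ty; apply: tail_ge => //; apply: spos; exact: le_trans yt.
move=> n t tT; have t0 : 0 < t by lra.
have t2 m : T <= 2 ^+ m * t by rewrite (le_trans tT)// ler_peMl ?exprn_ege1//; lra.
apply: inv_scaled_geometric; rewrite ?spos//; first by rewrite (lt_le_trans T0).
have := @geometric_of_tails _ (fun m => fine (I (2 ^+ m * t)))
  (fun m => (2 ^+ m * t) `^ b / s (2 ^+ m * t)) c C c0 C0 _ _ _ n.
rewrite expr0 mul1r; apply.
- by move=> m; rewrite fine_ge0 ?I0.
- by move=> m; rewrite -lee_fin fineK ?Ifin//; exact: HC.
- move=> m; rewrite -lee_fin EFinD !fineK ?Ifin// exprS -mulrA /I.
  have m0 : 0 < 2 ^+ m * t by exact: lt_le_trans (t2 m).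
  have m2 : 2 ^+ m * t <= 2 * (2 ^+ m * t) by lra.
  rewrite [leRHS](tail_integral_split b smono s0 (ltW m0) (spos _ (t2 m)) m2)//.
  by rewrite addeC leeD2r// block.
Qed.

Lemma grows_above_of_tail_sum (C : R) (P : nat) : 0 < C -> (0 < P)%N -> 0 < s P%:R ->
  (forall p : nat, (P <= p)%N ->
    (\sum_(p <= k <oo) ((k%:R : R) `^ (b - 1) / s k%:R)%:E
      <= (C * (p%:R `^ b / s p%:R))%:E)%E) ->
  grows_above s b.
Proof.
move=> C0 P0 sP HC; pose c := (2 `^ (b + 1))^-1 : R.
have c0 : 0 < c by rewrite invr_gt0 powR_gt0.
have cC : 0 < c / C by rewrite divr_gt0.
have Cc : 0 < C / c by rewrite divr_gt0.
apply: (@grows_above_of_nat_geometric _ s b 2 (1 + c / C) P (1 + C / c)) => //; try lra.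
pose u k := ((k%:R : R) `^ (b - 1) / s k%:R)%:E.
have u0 k : (0 <= u k)%E by rewrite lee_fin tail_ge0.
pose I p := (\sum_(p <= k <oo) u k)%E.
have I0 p : (0 <= I p)%E by exact: nneseries_ge0.
have Ifin p : (P <= p)%N -> I p \is a fin_num.
  by move=> Pp; rewrite ge0_fin_numE// (le_lt_trans (HC _ Pp))// ltry.
have spos p : (P <= p)%N -> 0 < s p%:R.
  by move=> Pp; rewrite (lt_le_trans sP)// smono// ler_nat.
move=> n p Pp.
have p2 m : (P <= 2 ^ m * p)%N by rewrite (leq_trans Pp)// leq_pmull// expn_gt0.
have pos q : (P <= q)%N -> 0 < q%:R :> R by move=> Pq; rewrite ltr0n (leq_trans P0).
apply: inv_scaled_geometric; rewrite ?spos ?pos//.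
have := @geometric_of_tails _ (fun m => fine (I (2 ^ m * p)%N))
  (fun m => (2 ^ m * p)%:R `^ b / s (2 ^ m * p)%:R) c C c0 C0 _ _ _ n.
rewrite expn0 mul1n; apply.
- by move=> m; rewrite fine_ge0.
- by move=> m; rewrite -lee_fin fineK ?Ifin//; exact: HC.
move=> m; rewrite -lee_fin EFinD !fineK ?Ifin// expnS -mulnA.
have := p2 m; set q := (2 ^ m * p)%N => Pq.
(* Cutting the series at [2 * q] isolates [q] terms, each at least a [q]-th of the required
   amount. *)
rewrite [leRHS]/I (nneseries_split _ q)// addnn -mul2n addeC leeD2r//.
rewrite sumEFin lee_fin.
have -> : c * ((2 * q)%:R `^ b / s (2 * q)%:R) =
    \sum_(q <= j < 2 * q) c * ((2 * q)%:R `^ b / s (2 * q)%:R) / q%:R.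
  rewrite sumr_const_nat mul2n -addnn addnK -[RHS]mulr_natr divfK//.
  by rewrite gt_eqF// pos.
apply: ler_sum_nat => j /andP[qj jq]; rewrite natrM.
by apply: tail_ge; rewrite -?natrM ?pos ?spos ?ler_nat// ?(leq_trans Pq)// ltnW.
Qed.

End Converses.

(** * Growth and limits of ratios *)

Section Ratios.
Variables (R : realType) (s : R -> R) (b a : R).
Hypothesis smono : forall x y : R, 0 <= x -> x <= y -> s x <= s y.
Hypothesis s0 : forall x : R, 0 <= x -> 0 <= s x.
Hypothesis b0 : 0 <= b.
Hypothesis spos : forall x : R, a <= x -> 0 < s x.

(** This turns the quotients of (ii) and of the Matuszewska index into quotients of [scaled]; the
    index needs exponents [g] other than [b]. *)
Lemma scaled_ratio (g K t : R) : 0 < K -> 0 < t -> 0 < s t ->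
  s (K * t) / (K `^ g * s t) = scaled s g (K * t) / scaled s g t.
Proof.
move=> K0 t0 st; rewrite /scaled powRM ?(ltW K0) ?(ltW t0)//.
by field; rewrite !gt_eqF ?powR_gt0.
Qed.

Lemma grows_above_of_ratio (K q T : R) : 1 < K -> 1 < q -> 0 < T ->
  (forall t, T <= t -> q * scaled s b t <= scaled s b (K * t)) ->
  grows_above s b.
Proof.
move=> K1 q1 T0 H.
apply: (@grows_above_of_geometric _ s b K q T 1) => // n t Tt; rewrite mul1r.
elim: n => [|n IH]; first by rewrite !expr0 mulr1 mul1r.
rewrite !exprS mulrCA -mulrA; apply: le_trans (H _ _).
  by rewrite ler_wpM2l//; lra.
by rewrite (le_trans Tt)// ler_peMl ?exprn_ege1//; lra.
Qed.

Lemma grows_above_of_nat_ratio (k : nat) (q : R) (P : nat) :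
  (1 < k)%N -> 1 < q -> (0 < P)%N ->
  (forall p, (P <= p)%N -> q * scaled s b p%:R <= scaled s b (k * p)%:R) ->
  grows_above s b.
Proof.
move=> k1 q1 P0 H.
apply: (@grows_above_of_nat_geometric _ s b k q P 1) => // n p Pp; rewrite mul1r.
elim: n => [|n IH]; first by rewrite !expr0 mulr1 mul1n.
rewrite exprS expnS mulrCA -mulnA; apply: le_trans (H _ _).
  by rewrite ler_wpM2l//; lra.
by rewrite (leq_trans Pp)// leq_pmull// expn_gt0 (leq_trans _ k1).
Qed.

Lemma liminf_ratio_cvgy : grows_above s b ->
  liminf_pinfty (fun t => (s (k * t) / (k `^ b * s t))%:E) @[k --> +oo] --> +oo%E.
Proof.
move=> gr; apply/cvgeyPge => A.
(* [A] may be negative or zero; the maximum has a positive inverse, usable as [th] in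
   [grows_above_ratio]. *)
have A1 : 1 <= Num.max A 1 by rewrite le_max lexx orbT.
have A0 : 0 < Num.max A 1 by lra.
have A0V : 0 < (Num.max A 1)^-1 by rewrite invr_gt0.
have [k0 [k02 ratio]] := grows_above_ratio smono s0 b0 gr ltr01 A0V.
have k0gt : 0 < k0%:R :> R by rewrite ltr0n (leq_trans _ k02).
near=> k; apply: limf_einf_ge; near=> t.
have k0k : k0%:R <= k by near: k; exact: (nbhs_pinfty_ge (num_real _)).
have t1 : 1 <= t by near: t; exact: (nbhs_pinfty_ge (num_real _)).
have st : 0 < s t by apply: spos; near: t; exact: (nbhs_pinfty_ge (num_real _)).
have t0 : 0 < t by lra.
have k_gt0 : 0 < k by exact: lt_le_trans k0k.
rewrite /= lee_fin scaled_ratio//.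
have Ht : 0 < scaled s b t by exact: scaled_gt0.
apply: (@le_trans _ _ (Num.max A 1)); first by rewrite le_max lexx.
rewrite ler_pdivlMr// mulrC -ler_pdivlMr// mulrC; apply: ratio => //.
by rewrite ler_pM2r.
Unshelve. all: by end_near. Qed.

Lemma liminf_ratio_gt :
  liminf_pinfty (fun t => (s (k * t) / (k `^ b * s t))%:E) @[k --> +oo] --> +oo%E ->
  exists K : R, 1 < K /\
    ((K `^ b)%:E < liminf_pinfty (fun t => (s (K * t) / s t)%:E))%E.
Proof.
(* The value 2 leaves room above 1, hence a strict inequality after multiplication by [K ^ b]. *)
move=> /cvgeyPge/(_ 2)/(near_pinfty_ex 1)[K [K1 /(_ K (lexx _)) HK]].
exists K; split=> //; have Kb : 0 < K `^ b by rewrite powR_gt0//; lra.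
have : (1%:E < liminf_pinfty (fun t => (s (K * t) / (K `^ b * s t))%:E))%E.
  by apply: lt_le_trans HK; rewrite lte_fin; lra.
move=> /limf_einf_gt[c [c1 Hc]].
apply: (@lt_le_trans _ _ (c * K `^ b)%:E); first by rewrite lte_fin ltr_pMl.
apply: limf_einf_ge; apply: filterS Hc => t /=; rewrite !lee_fin.
by rewrite (mulrC (K `^ b)) invfM mulrA ler_pdivlMr.
Qed.

(** Some real [c > K ^ b] eventually bounds the quotient from below, so each step by [K] multiplies
    H by at least [c / K ^ b > 1]. *)
Lemma grows_above_of_liminf (K : R) : 1 < K ->
  ((K `^ b)%:E < liminf_pinfty (fun t => (s (K * t) / s t)%:E))%E ->
  grows_above s b.
Proof.
move=> K1 /limf_einf_gt[c [Kc /(near_pinfty_ex (Num.max a 1))[T [aT HT]]]].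
have K0 : 0 < K by lra.
have Kb : 0 < K `^ b by rewrite powR_gt0.
move: aT; rewrite gt_max => /andP[aT T1].
have q1 : 1 < c / K `^ b by rewrite ltr_pdivlMr// mul1r.
apply: (@grows_above_of_ratio K (c / K `^ b) T) => //; first lra.
move=> t Tt; have t0 : 0 < t by lra.
have st : 0 < s t by apply: spos; lra.
rewrite -ler_pdivlMr ?scaled_gt0// -scaled_ratio// mulrC.
by rewrite invfM mulrA [X in _ <= X]mulrAC mulrC ler_pM2r ?invr_gt0// -lee_fin HT.
Qed.

(** The exponent [g] is itself admissible in the supremum, with [D = M^-1] for every [L], since
    almost-increase treats all [lam >= 1] at once. *)
Lemma matuszewska_lower_gt : grows_above s b -> (b%:E < matuszewska_lower s)%E.
Proof.
move=> [g [bg [A [A0 [M [M0 HM]]]]]].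
apply: (@lt_le_trans _ _ g%:E); first by rewrite lte_fin.
apply: ereal_sup_ubound; exists g => //=; exists M^-1; split; first by rewrite invr_gt0.
move=> L L1; apply: limf_einf_ge; near=> x => /=.
have Ax : A <= x by near: x; exact: (nbhs_pinfty_ge (num_real _)).
have sx : 0 < s x by apply: spos; near: x; exact: (nbhs_pinfty_ge (num_real _)).
have x0 : 0 < x by lra.
apply/ereal_infP => _ [l + <-]; rewrite /= in_itv/= => /andP[l1 _].
have l0 : 0 < l by lra.
rewrite lee_fin scaled_ratio// ler_pdivlMr ?scaled_gt0// mulrC ler_pdivrMr//.
by rewrite mulrC; apply: HM => //; rewrite ler_peMl// ltW.
Unshelve. all: by end_near. Qed.

(** [D] may be small, but lowering the exponent from [g] to [b] gains [lam ^ (g - b)]. It suffices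
    to take [lam = L = k] with [k ^ (g - b) >= 4 / D]. *)
Lemma grows_above_of_matuszewska : (b%:E < matuszewska_lower s)%E -> grows_above s b.
Proof.
move=> /ereal_sup_gt[_ [g [D [D0 HD]] <-]]; rewrite lte_fin => bg.
have d0 : 0 < g - b by rewrite subr_gt0.
have [k [k2 /(_ _ (lexx _)) kd]] := powR_nat_ge (4 / D) d0.
have k1 : 1 < k%:R :> R by rewrite ltr1n.
have k0 : 0 < k%:R :> R by lra.
(* Halving [D] gives the strict inequality that [limf_einf_gt] asks for; then [D / 2 * (4 / D) = 2]
   is the growth rate. *)
have : ((D / 2)%:E < liminf_pinfty (fun x : R =>
    ereal_inf [set ((s (l * x) / (l `^ g * s x))%:E)%E | l in `[1%R, k%:R]%classic]))%E.
  by apply: lt_le_trans (HD _ k1); rewrite lte_fin; lra.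
move=> /limf_einf_gt[c [Dc /(near_pinfty_ex (Num.max a 1))[T [aT HT]]]].
move: aT; rewrite gt_max => /andP[aT T1].
apply: (@grows_above_of_ratio k%:R 2 T) => //; [lra|lra|move=> t Tt].
have t0 : 0 < t by lra.
have st : 0 < s t by apply: spos; lra.
rewrite -ler_pdivlMr ?scaled_gt0// -scaled_ratio//.
have : (c%:E <= (s (k%:R * t) / (k%:R `^ g * s t))%:E)%E.
  apply: (le_trans (HT t Tt)); apply: ereal_inf_lbound.
  by exists k%:R => //=; rewrite in_itv/= lexx andbT ltW.
rewrite lee_fin (_ : g = b + (g - b)); last lra.
rewrite powRD_gt0// => h.
have kd0 : 0 < k%:R `^ (g - b) :> R by exact: powR_gt0.
have kb0 : 0 < k%:R `^ b :> R by exact: powR_gt0.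
have -> : s (k%:R * t) / (k%:R `^ b * s t) =
    s (k%:R * t) / (k%:R `^ b * k%:R `^ (g - b) * s t) * k%:R `^ (g - b).
  by field; rewrite !gt_eqF.
apply: (@le_trans _ _ (D / 2 * (4 / D))).
  by rewrite le_eqVlt predU1l//; field; rewrite gt_eqF.
apply: ler_pM => //; [rewrite divr_ge0//; lra|rewrite divr_ge0//; lra|lra].
Qed.

Lemma nat_ratio (th : R) : grows_above s b -> 0 < th ->
  exists k : nat, (2 <= k)%N /\ forall p : nat, (1 <= p)%N ->
    s p%:R <= th * k%:R `^ (- b) * s (k%:R * p%:R).
Proof.
move=> gr th0; have [k [k2 ratio]] := grows_above_ratio smono s0 b0 gr ltr01 th0.
exists k; split=> // p p1; have p0 : 0 < p%:R :> R by rewrite ltr0n.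
have := ratio p%:R (k%:R * p%:R); rewrite ler1n => /(_ p1 (lexx _)).
rewrite /scaled powRM// powRN ler_pdivrMr ?powR_gt0// => /le_trans; apply.
rewrite le_eqVlt predU1l//; field.
by rewrite !gt_eqF// powR_gt0// ltr0n (leq_trans _ k2).
Qed.

Lemma limn_einf_ratio_gt (k : nat) : (2 <= k)%N ->
  (forall p : nat, (1 <= p)%N -> s p%:R <= 2^-1 * k%:R `^ (- b) * s (k%:R * p%:R)) ->
  (((k%:R : R) `^ b)%:E
     < limn_einf (fun p : nat => (s (k%:R * p%:R) / s p%:R)%:E))%E.
Proof.
move=> k2 H; have kb : 0 < (k%:R : R) `^ b by rewrite powR_gt0// ltr0n (leq_trans _ k2).
apply: (@lt_le_trans _ _ (2 * k%:R `^ b)%:E); first by rewrite lte_fin ltr_pMl//; lra.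
apply: limf_einf_ge; near=> p => /=.
have sp : 0 < s p%:R.
  by apply: spos; near: p; exact: nbhs_infty_ger.
have p1 : (1 <= p)%N by near: p; exact: nbhs_infty_ge.
have := H p p1; rewrite powRN lee_fin ler_pdivlMr//.
rewrite -(ler_pM2l (mulr_gt0 (ltr0Sn R 1) kb)) => /le_trans; apply.
by rewrite le_eqVlt predU1l//; field; rewrite gt_eqF.
Unshelve. all: by end_near. Qed.

Lemma grows_above_of_limn_einf (k : nat) : (2 <= k)%N ->
  (((k%:R : R) `^ b)%:E
     < limn_einf (fun p : nat => (s (k%:R * p%:R) / s p%:R)%:E))%E ->
  grows_above s b.
Proof.
move=> k2 /limf_einf_gt[c [kc [N _ HN]]].
have k0 : 0 < k%:R :> R by rewrite ltr0n (leq_trans _ k2).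
have kb : 0 < (k%:R : R) `^ b by rewrite powR_gt0.
(* From [P] on, both the eventual bound and the positivity of [s] hold. *)
pose P := (maxn N (Num.truncn a)).+1.
have q1 : 1 < c / k%:R `^ b by rewrite ltr_pdivlMr// mul1r.
apply: (@grows_above_of_nat_ratio k (c / k%:R `^ b) P) => // p Pp.
have p0 : 0 < p%:R :> R by rewrite ltr0n (leq_trans _ Pp).
have sp : 0 < s p%:R.
  apply: spos; rewrite ltW// (lt_le_trans (truncnS_gt a))// ler_nat.
  by rewrite (leq_trans _ Pp)// ltnS leq_maxr.
rewrite natrM -ler_pdivlMr ?scaled_gt0// -scaled_ratio// mulrC.
rewrite invfM mulrA [X in _ <= X]mulrAC mulrC ler_pM2r ?invr_gt0// -lee_fin.
by apply: HN => /=; rewrite (leq_trans _ Pp)// leqW// leq_maxl.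
Qed.

End Ratios.

(** * The ten equivalent conditions *)

Theorem theorem2p16 (R : realType) (sigma : R -> R) (beta a : R) :
  (forall x y : R, 0 <= x -> x <= y -> sigma x <= sigma y) ->
  (forall x : R, 0 <= x -> 0 <= sigma x) ->
  sigma x @[x --> +oo] --> +oo ->
  0 <= beta ->
  0 <= a ->
  (forall x : R, a <= x -> 0 < sigma x) ->
  (forall x : R, 0 <= x -> x <= (Num.ceil a)%:~R - 1 -> sigma x = 0) ->
  [<->
  (* (i) *)
  (exists C : R, 0 < C /\ forall y : R, 1 <= y ->
     (\int[lebesgue_measure]_(t in `[1%R, y]%classic) (sigma t / t `^ (beta + 1))%:E
       <= (C * (sigma y / y `^ beta))%:E)%E);
  (* (ii) *)
  (liminf_pinfty (fun t => (sigma (k * t) / (k `^ beta * sigma t))%:E)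
     @[k --> +oo] --> +oo%E);
  (* (iii) *)
  (exists K : R, 1 < K /\
     ((K `^ beta)%:E < liminf_pinfty (fun t => (sigma (K * t) / sigma t)%:E))%E);
  (* (iv) *)
  (beta%:E < matuszewska_lower sigma)%E;
  (* (v) *)
  (exists gamma : R, beta < gamma /\
     (if 0 < a then almost_increasing (fun t => sigma t / t `^ gamma) a
      else forall eps : R, 0 < eps ->
             almost_increasing (fun t => sigma t / t `^ gamma) eps));
  (* (vi) *)
  (if 0 < a then
     exists C : R, 0 < C /\ forall y : R, a <= y ->
       ((1 / y `^ beta)%:E *
          \int[lebesgue_measure]_(t in `[y, +oo[%classic) (t `^ (beta - 1) / sigma t)%:E
        <= (C / sigma y)%:E)%E
   else forall eps : R, 0 < eps ->
     exists C : R, 0 < C /\ forall y : R, eps <= y ->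
       ((1 / y `^ beta)%:E *
          \int[lebesgue_measure]_(t in `[y, +oo[%classic) (t `^ (beta - 1) / sigma t)%:E
        <= (C / sigma y)%:E)%E);
  (* (vii) *)
  (exists C : R, 0 < C /\ forall p : nat, (1 <= p)%N -> a <= p%:R ->
     (\sum_(p <= k <oo) ((k%:R : R) `^ (beta - 1) / sigma k%:R)%:E
       <= (C * ((p%:R : R) `^ beta / sigma p%:R))%:E)%E);
  (* (viii) *)
  (forall theta : R, 0 < theta < 1 -> exists k : nat, (2 <= k)%N /\
     forall p : nat, (1 <= p)%N ->
       sigma p%:R <= theta * (k%:R : R) `^ (- beta) * sigma (k%:R * p%:R));
  (* (ix) *)
  (exists k : nat, (2 <= k)%N /\
     (((k%:R : R) `^ beta)%:E
        < limn_einf (fun p : nat => (sigma (k%:R * p%:R) / sigma p%:R)%:E))%E);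
  (* (x) *)
  (exists C : R, 0 < C /\ forall p : nat, (1 <= p)%N ->
     \sum_(1 <= k < p.+1) sigma k%:R / (k%:R : R) `^ (1 + beta)
       <= C * (sigma p%:R / (p%:R : R) `^ beta))
  ].
Proof.
move=> smono s0 _ beta0 a0 spos _; have h0 : 0 < (2^-1 : R) < 1 by lra.
(* Multiplying (vi) by [y ^ beta] brings it to the form of the tail lemmas. *)
have vi_gen (C y : R) (I : \bar R) : 0 < y ->
    ((1 / y `^ beta)%:E * I <= (C / sigma y)%:E)%E =
    (I <= (C * (y `^ beta / sigma y))%:E)%E.
  move=> y0; rewrite div1r lee_pdivrMl ?powR_gt0// -EFinM.
  by congr (_ <= _%:E)%E; ring.
(* The implications run in a cycle from (i) to (x) and back to (i). All pass through [grows_above],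
   except (ii) to (iii) and (viii) to (ix), which are direct. *)
tfae.
- move=> [C [C0 H]]; have gr := grows_above_of_head_integral smono s0 beta0 C0 H.
  exact: (liminf_ratio_cvgy smono s0 beta0 spos gr).
- exact: liminf_ratio_gt.
- move=> [K [K1 H]].
  exact/(matuszewska_lower_gt spos)/(grows_above_of_liminf smono s0 beta0 spos K1 H).
- move=> /(grows_above_of_matuszewska smono s0 beta0 spos)[g [bg [A [A0 HA]]]].
  have g0 : 0 <= g by lra.
  exists g; split=> //; case: ifPn => [a_gt0|_ eps eps0];
    exact: almost_increasing_extend HA.
- move=> [g [bg H]].
  have gr : grows_above sigma beta.
    exists g; split=> //; move: H; case: ifPn => [a_gt0|_] H; first by exists a.
    (* If [a = 0], condition (v) holds from every positive point; 1 is taken. *)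
    by exists 1; split=> //; exact: H.
  case: ifPn => [a_gt0|a_le0 eps eps0].
    have [C [C0 H']] := tail_integral_le smono s0 beta0 gr a_gt0 (spos _ (lexx _)).
    by exists C; split=> // y ay; rewrite vi_gen ?H'// (lt_le_trans a_gt0).
  have se : 0 < sigma eps by apply: spos; rewrite -leNgt in a_le0; lra.
  have [C [C0 H']] := tail_integral_le smono s0 beta0 gr eps0 se.
  by exists C; split=> // y ay; rewrite vi_gen ?H'// (lt_le_trans eps0).
- move=> H; have gr : grows_above sigma beta.
    move: H; case: ifPn => [a_gt0 [C [C0 H]]|a_le0 /(_ 1 ltr01)[C [C0 H]]].
      apply: (grows_above_of_tail_integral smono s0 beta0 C0 a_gt0 (spos _ (lexx _))).
      by move=> y ay; rewrite -vi_gen ?H// (lt_le_trans a_gt0).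
    have s1 : 0 < sigma 1 by apply: spos; rewrite -leNgt in a_le0; lra.
    apply: (grows_above_of_tail_integral smono s0 beta0 C0 ltr01 s1).
    by move=> y ay; rewrite -vi_gen ?H// (lt_le_trans ltr01).
  have [C [C0 H']] := tail_sum_le smono s0 beta0 gr.
  by exists C; split=> // p p1 ap; exact/H'/spos.
- move=> [C [C0 H]] theta /andP[theta0 _]; apply: nat_ratio => //.
  (* [(Num.truncn a).+1] is a positive integer not below [a], so (vii) applies from it on. *)
  have aP : a <= (Num.truncn a).+1%:R by rewrite ltW// truncnS_gt.
  apply: (grows_above_of_tail_sum smono s0 beta0 C0 (ltn0Sn _) (spos _ aP)).
  move=> p Pp; apply: H; first exact: leq_trans Pp.
  by rewrite (le_trans aP)// ler_nat.
- move=> /(_ _ h0)[k [k2 H]]; exists k; split=> //; exact: (limn_einf_ratio_gt spos k2 H).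
- move=> [k [k2 H]]; apply: head_sum_le => //.
  exact: (grows_above_of_limn_einf smono s0 beta0 spos k2 H).
- move=> [C [C0 H]]; apply: head_integral_le => //.
  exact: (grows_above_of_head_sum smono s0 beta0 C0 H).
Qed.
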